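(* Let $G$ be a finite group with identity element $1$, and let $\chi: G \to \mathbb{C}$ be a class function, written as $\chi = \sum_{\lambda} m_\lambda \chi_\lambda$ with $m_\lambda \in \mathbb{C}$, where $\lambda$ runs over the (isomorphism classes of) irreducible complex representations of $G$ and $\chi_\lambda$ is the character of $\lambda$. Let $H = (V,E)$ be a connected directed graph equipped with a rotation system, and let $F$ be its set of faces. Then \[ P_\chi(H) = |G|^{|E|} \sum_{\lambda} \chi_\lambda(1)^{|F|-|E|}\, m_\lambda^{|V|}. \]
   Context: Graphs may have multiple edges and loops. A rotation system on $H$ assigns to every vertex $v$ a cyclic order $\phi_v$ of the edge-ends (half-edges) at $v$; a loop at $v$ contributes two edge-ends and so appears twice in $\phi_v$. For a non-isolated vertex $v$ of total degree $d(v)$, list its edge-ends in cyclic order as $e_v^1,\dots,e_v^{d(v)}$ and let $\sigma_v(e_v^i) = +1$ if that edge-end is the head of its edge (edge directed into $v$) and $-1$ if it is the tail (edge directed out of $v$). The partition function is \[ P_\chi(H) = \sum_{\kappa: E \to G} \prod_{v \in V} \chi\Big(\prod_{i=1}^{d(v)} \kappa(e_v^i)^{\sigma_v(e_v^i)}\Big), \] where the empty product is $1$; this does not depend on the choice of starting edge-end $e_v^1$ since $\chi$ is a class function. Faces: consider the set of darts (each edge traversed in one of its two directions); after traversing a dart along edge $e$ into vertex $w$, the next dart leaves $w$ along the edge-end following the edge-end of $e$ at $w$ in the cyclic order $\phi_w$. The faces of $H$ are the cycles (closed facial walks) of this permutation of darts, i.e., the faces of the cellular embedding of $H$ in a closed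 orientable surface determined by the rotation system; by convention a graph consisting of a single vertex and no edges has one face. *)

(* Defs.v *)
From HB Require Import structures.
From mathcomp Require Import all_boot all_order all_algebra all_fingroup.
From mathcomp Require Import all_character.
From mathcomp Require Import reals complex.

Set Implicit Arguments.
Unset Strict Implicit.
Unset Printing Implicit Defensive.

Import GRing.Theory.
Local Open Scope ring_scope.

(* Finite directed graphs, with loops and multiple edges allowed. *)
Record digraph := Digraph {
  vertex : finType;
  edge : finType;
  source : edge -> vertex;
  target : edge -> vertex
}.

(* (e, true) is the head of e and (e, false) its tail, so a loop contributes
   two distinct edge-ends to its vertex. *)
Definition edge_end (H : digraph) : finType := (edge H * bool)%type.

Definition end_vertex (H : digraph) (h : edge_end H) : vertex H :=
  if h.2 then target h.1 else source h.1.

Definition adjacent (H : digraph) : rel (vertex H) :=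
  [rel u v | [exists e : edge H,
     ((source e == u) && (target e == v)) ||
     ((source e == v) && (target e == u))]].

Definition connected_digraph (H : digraph) : Prop :=
  (0 < #|vertex H|)%N /\ forall u v : vertex H, connect (@adjacent H) u v.

(* The cyclic order at v is given by a list of the edge-ends at v, read
   cyclically; the first entry of the list is the chosen starting edge-end. *)
Record rotation_system (H : digraph) := RotationSystem {
  rot_at :> vertex H -> seq (edge_end H);
  rot_uniq : forall v, uniq (rot_at v);
  mem_rot_at : forall v h, (h \in rot_at v) = (end_vertex h == v)
}.

Definition partition_function (C : comNzRingType) (G : finGroupType)
    (chi : G -> C) (H : digraph) (phi : rotation_system H) : C :=
  \sum_(kappa : {ffun edge H -> G}) \prod_(v : vertex H)
     chi (\prod_(h <- phi v)
            (if h.2 then kappa h.1 else (kappa h.1)^-1))%g.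

(* A dart is identified with the edge-end at which it arrives; the dart leaving
   along the edge-end (e, b) therefore is (e, ~~ b). *)
Definition face_next (H : digraph) (phi : rotation_system H)
    (d : edge_end H) : edge_end H :=
  let h := next (phi (end_vertex d)) d in (h.1, ~~ h.2).

Lemma face_next_inj (H : digraph) (phi : rotation_system H) :
  injective (face_next phi).
Proof.
move=> d d'; rewrite /face_next.
have memd x : x \in phi (end_vertex x) by rewrite mem_rot_at.
have endn x : end_vertex (next (phi (end_vertex x)) x) = end_vertex x.
  by apply/eqP; rewrite -(mem_rot_at phi) mem_next memd.
move: (endn d) (endn d').
case E: (next _ d) => [e b]; case E': (next _ d') => [e' b'] /= end1 end2.
case=> eq_e /negb_inj eq_b; move: E E'; subst e' b'.
rewrite -end1 -end2 => E E'.
have U := rot_uniq phi (end_vertex (e, b)).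
by rewrite -(prev_next U d) E -(prev_next U d') E'.
Qed.

Definition faces (H : digraph) (phi : rotation_system H) :
    {set {set edge_end H}} :=
  [set [set d' | fconnect (face_next phi) d d'] | d : edge_end H].

(* The one-vertex graph without edges has no dart, but one face. *)
Definition num_faces (H : digraph) (phi : rotation_system H) : nat :=
  if (#|vertex H| == 1%N) && (#|edge H| == 0%N) then 1%N else #|faces phi|.

Definition class_function (C : Type) (G : finGroupType) (chi : G -> C) : Prop :=
  forall x y : G, chi (x ^ y)%g = chi x.

(* rho lists each isomorphism class of irreducible representations of G over
   the field C exactly once. *)
Definition complete_irreps (C : fieldType) (G : finGroupType) (I : finType)
    (n : I -> nat) (rho : forall i, mx_representation C [set: G] (n i)) : Prop :=
  [/\ forall i, mx_irreducible (rho i),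
      forall i j, mx_rsim (rho i) (rho j) -> i = j
    & forall (m : nat) (r : mx_representation C [set: G] m),
        mx_irreducible r -> exists i, mx_rsim r (rho i)].

Definition repr_char (C : fieldType) (G : finGroupType) (n : nat)
    (r : mx_representation C [set: G] n) (g : G) : C := \tr (r g).

(* Main.v *)
Require Import Defs.
From HB Require Import structures.
From mathcomp Require Import all_boot all_order all_algebra all_fingroup.
From mathcomp Require Import all_character.
From mathcomp Require Import reals complex.

Set Implicit Arguments.
Unset Strict Implicit.
Unset Printing Implicit Defensive.

Import GRing.Theory.
Local Open Scope ring_scope.

(** Let [X] be the set of pairs of an irreducible representation [i] and a
    basis index of it. Expanding the character at each vertex as a trace puts a
    label in [X] on every edge-end, the label of [h] being the row index of the
    matrix of [h] and the label of the edge-end following [h] its column index.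
    Summing over the group element carried by an edge, Schur orthogonality
    replaces the two matrix entries at its ends by [|G| / dim i] if the labels
    match across the edge and all carry the same [i], and by [0] otherwise. By
    connectedness a surviving labelling involves a single [i], and the matching
    condition says exactly that labels, read off at the opposite end of each
    edge, are constant along facial walks. So each [i] contributes
    [(dim i)^|F|] labellings, each of weight [m_i^|V| (|G| / dim i)^|E|]. *)

(** * Intertwiners and Schur's lemma *)

(** The kernel and the row space of [f] are submodules. As [f] is nonzero, irreducibility makes the
    first zero and the second everything, so [f] is square and invertible. *)
Lemma intertwiner_rsim (F : fieldType) (gT : finGroupType) (G : {group gT})
    n1 n2 (r1 : mx_representation F G n1) (r2 : mx_representation F G n2)
    (f : 'M_(n1, n2)) :
    mx_irreducible r1 -> mx_irreducible r2 ->
    {in G, forall x, r1 x *m f = f *m r2 x} -> f != 0 -> mx_rsim r1 r2.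
Proof.
move=> /mx_irrP[n1_gt0 irr1] /mx_irrP[n2_gt0 irr2] homf nzf.
have free_f : row_free f.
  rewrite -kermx_eq0; apply: contraNT nzf => nz_ker.
  have modK : mxmodule r1 (kermx f).
    apply/mxmoduleP=> x Gx; apply/sub_kermxP.
    by rewrite -mulmxA homf // mulmxA mulmx_ker mul0mx.
  have := irr1 _ modK nz_ker; rewrite -sub1mx => /sub_kermxP.
  by rewrite mul1mx => ->.
have full_f : row_full f.
  have modI : mxmodule r2 <<f>>%MS.
    apply/mxmoduleP=> x Gx; rewrite (eqmxMr _ (genmxE f)) genmxE -homf //.
    exact: submxMl.
  have nzI : <<f>>%MS != 0 by rewrite -mxrank_eq0 genmxE mxrank_eq0.
  by have := irr2 _ modI nzI; rewrite /row_full genmxE.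
have eq_n : n1 = n2 := etrans (esym (eqP free_f)) (eqP full_f).
exact: MxReprSim eq_n free_f homf.
Qed.

(** An eigenvalue [c] exists because the field is algebraically closed. The commuting matrix
    [f - c%:M] is singular, hence zero by Schur's lemma. *)
Lemma intertwiner_scalar (F : closedFieldType) (gT : finGroupType)
    (G : {group gT}) n (r : mx_representation F G n) (f : 'M_n) :
    mx_irreducible r -> {in G, forall x, r x *m f = f *m r x} ->
  exists c, f = c%:M.
Proof.
move=> irr homf; have [n_gt0 _] := (mx_irrP r).1 irr.
have [c] : exists c, root (char_poly f) c.
  by apply/closed_rootP; rewrite size_char_poly; case: (n) n_gt0.
rewrite -eigenvalue_root_char => /eigenvalueP[v fv nzv].
exists c; apply/eqP; rewrite -subr_eq0; apply: contraNT nzv => nzfc.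
have cent : centgmx r (f - c%:M).
  apply/centgmxP=> x Gx.
  by rewrite mulmxBl mulmxBr homf // scalar_mxC.
have /mulmxK := mx_Schur irr cent nzfc => K.
have : v *m (f - c%:M) = 0 by rewrite mulmxBr fv mul_mx_scalar subrr.
by move=> v0; rewrite -(K _ v) v0 mul0mx.
Qed.

(** * Orthogonality of matrix entries by averaging over the group *)

Section SchurOrthogonality.

Variables (C : numClosedFieldType) (G : finGroupType).

Lemma average_intertwines n1 n2 (r1 : mx_representation C [set: G] n1)
    (r2 : mx_representation C [set: G] n2) (B : 'M_(n1, n2)) :
  {in [set: G]%G, forall x, r1 x *m (\sum_(g : G) r1 g *m B *m r2 (g^-1)%g)
    = (\sum_(g : G) r1 g *m B *m r2 (g^-1)%g) *m r2 x}.
Proof.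
move=> x _; rewrite mulmx_sumr mulmx_suml.
rewrite [RHS](reindex_inj (mulgI x)) /=; apply: eq_bigr => g _.
rewrite invMg !repr_mxM ?inE // !mulmxA.
by rewrite -[RHS]mulmxA -(repr_mxM r2) ?inE // mulVg repr_mx1 mulmx1.
Qed.

(** Averaging an elementary matrix isolates a single product of entries, so orthogonality becomes a
    statement about intertwiners. *)
Lemma average_deltaE n1 n2 (r1 : mx_representation C [set: G] n1)
    (r2 : mx_representation C [set: G] n2) a b c d :
  (\sum_(g : G) r1 g *m delta_mx b c *m r2 (g^-1)%g) a d =
  \sum_(g : G) r1 g a b * r2 (g^-1)%g c d.
Proof.
rewrite summxE; apply: eq_bigr => g _; rewrite mxE (bigD1 c) //= big1 => [|k nk].
  rewrite addr0; congr (_ * _); rewrite mxE (bigD1 b) //= big1 => [|k nk].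
    by rewrite mxE !eqxx mulr1 addr0.
  by rewrite mxE (negPf nk) mulr0.
rewrite mxE big1 ?mul0r // => l _.
by rewrite mxE (negPf nk) andbF mulr0.
Qed.

Lemma schur_orthogonality_neq n1 n2 (r1 : mx_representation C [set: G] n1)
    (r2 : mx_representation C [set: G] n2) a b c d :
    mx_irreducible r1 -> mx_irreducible r2 -> ~ mx_rsim r1 r2 ->
  \sum_(g : G) r1 g a b * r2 (g^-1)%g c d = 0.
Proof.
move=> irr1 irr2 nsim; rewrite -average_deltaE.
set f := (X in fun_of_matrix X).
have [->|nzf] := eqVneq f 0; first by rewrite mxE.
by case: nsim; apply: intertwiner_rsim nzf => //; apply: average_intertwines.
Qed.

(** The average is a scalar matrix, and its trace fixes the scalar. *)
Lemma schur_orthogonality_eq n (r : mx_representation C [set: G] n) a b c d :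
    mx_irreducible r ->
  \sum_(g : G) r g a b * r (g^-1)%g c d =
  #|G|%:R / n%:R *+ ((a == d) && (b == c)).
Proof.
move=> irr; have [n_gt0 _] := (mx_irrP r).1 irr.
rewrite -average_deltaE.
have [k fk] := intertwiner_scalar irr (average_intertwines r r (delta_mx b c)).
have : k *+ n = #|G|%:R *+ (b == c).
  rewrite -mxtrace_scalar -fk raddf_sum /=.
  (* Conjugation by [r g] preserves the trace, so each term has the trace of [delta_mx b c]. *)
  rewrite (eq_bigr (fun=> (b == c)%:R)) => [|g _].
    by rewrite sumr_const cardT -cardE -mulrnA mulnC mulrnA.
  rewrite mxtrace_mulC mulmxA -repr_mxM ?inE // mulVg repr_mx1 mul1mx.
  rewrite /mxtrace (bigD1 b) //= big1 => [|l nl]; last first.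
    by rewrite mxE (negPf nl).
  by rewrite mxE eqxx addr0.
have nz_n : n%:R != 0 :> C by rewrite Num.Theory.pnatr_eq0 -lt0n.
move=> kn; rewrite fk mxE.
have -> : k = (#|G|%:R *+ (b == c)) / n%:R by rewrite -kn -(mulr_natr k) mulfK.
by case: (a == d); case: (b == c); rewrite ?mulr0n ?mul0r ?mulr1n ?mul0rn.
Qed.

End SchurOrthogonality.

(** * Sums over labellings with prescribed support *)

Section Labellings.

Variables (E X : finType) (x0 : X).

(* Maps from [s] to [X] are encoded as maps on all of [E] with the default
   value [x0] outside [s]. *)
Definition supported (s : pred E) (a : {ffun E -> X}) :=
  [forall h, s h || (a h == x0)].

Definition relabel (a : {ffun E -> X}) h x : {ffun E -> X} :=
  [ffun k => if k == h then x else a k].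

Lemma sum_supported_nil (R : nmodType) (F : {ffun E -> X} -> R) :
  \sum_(a | supported (mem [::]) a) F a = F [ffun=> x0].
Proof.
rewrite (big_pred1 [ffun=> x0]) // => a; apply/forallP/eqP => [a0 | -> h].
  by apply/ffunP=> h; rewrite ffunE; apply/eqP/a0.
by rewrite ffunE eqxx orbT.
Qed.

Lemma sum_supported_cons (R : nmodType) (F : {ffun E -> X} -> R) h s :
    h \notin s ->
  \sum_(a | supported (mem (h :: s)) a) F a =
  \sum_x \sum_(a | supported (mem s) a) F (relabel a h x).
Proof.
move=> hs; rewrite pair_big_dep /=.
rewrite (reindex_onto (fun p => relabel p.2 h p.1)
                      (fun a => (a h, relabel a h x0))) /=; last first.
  by move=> a _; apply/ffunP=> k; rewrite !ffunE; case: eqP => [->|].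
apply: eq_bigl => -[x a] /=; rewrite /supported.
apply/andP/forallP => [[/forallP sup /eqP[_ ea]] k | sup].
  have := sup k; move/ffunP/(_ k): ea.
  rewrite -[mem (h :: s) k]/(k \in h :: s) in_cons !ffunE.
  by case: eqP => [_ <- _ | //]; rewrite eqxx orbT.
split.
  apply/forallP=> k; rewrite -[mem (h :: s) k]/(k \in h :: s) in_cons ffunE.
  by case: eqP => //= _; apply: sup.
apply/eqP; congr (_, _); rewrite ?ffunE ?eqxx //.
apply/ffunP=> k; rewrite !ffunE; case: eqP => [->|//].
by have := sup h; rewrite /= (negPf hs) => /eqP.
Qed.

(** Labellings supported on the disjoint fibres of [p] glue uniquely to a labelling of [E], so
    distributing the product over the sums yields each global labelling once. *)
Lemma prod_sum_supported (R : comNzRingType) (V : finType) (p : E -> V)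
    (F : V -> {ffun E -> X} -> R) :
    (forall v (a b : {ffun E -> X}), (forall h, p h = v -> a h = b h) -> F v a = F v b) ->
  \prod_v \sum_(a | supported [pred h | p h == v] a) F v a =
  \sum_a \prod_v F v a.
Proof.
move=> Fext; rewrite bigA_distr_big_dep.
pose glue (f : {ffun V -> {ffun E -> X}}) : {ffun E -> X} :=
  [ffun h => f (p h) h].
pose restr (a : {ffun E -> X}) : {ffun V -> {ffun E -> X}} :=
  [ffun v => [ffun h => if p h == v then a h else x0]].
rewrite (reindex_onto restr glue) /=; last first.
  move=> f /familyP supf; apply/ffunP=> v; apply/ffunP=> h; rewrite !ffunE.
  case: eqP => [->//|/eqP nv].
  by have /forallP/(_ h) := supf v; rewrite /= (negPf nv) => /eqP.
apply: eq_big => [a | a _].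
  apply/andP; split.
    apply/familyP=> v; apply/forallP=> h; rewrite /= !ffunE.
    by case: eqP => //= _; rewrite eqxx.
  by apply/eqP/ffunP=> h; rewrite !ffunE eqxx.
by apply: eq_bigr => v _; apply: Fext => h hv; rewrite !ffunE hv eqxx.
Qed.

Lemma eq_supported (s t : pred E) : s =1 t -> supported s =1 supported t.
Proof. by move=> st a; apply: eq_forallb => h; rewrite st. Qed.

End Labellings.

(** * Expansion of the trace of a product as a sum over closed walks *)

Section TraceExpansion.

Variables (R : comNzRingType) (G : finGroupType) (E X : finType) (x0 : X).
Variable D : G -> X -> X -> R.
Hypothesis D_mul : forall g h x y, D (g * h)%g x y = \sum_z D g x z * D h z y.
Variable g : E -> G.

(** Column index of the matrix preceding the walk along [s]; it is the closing label [y] when no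
    factor is left. *)
Definition start_label (a : {ffun E -> X}) y s := if s is h :: _ then a h else y.

Fixpoint walk_weight (a : {ffun E -> X}) y s :=
  if s is h :: s' then
    D (g h) (a h) (start_label a y s') * walk_weight a y s'
  else 1.

Lemma start_label_relabel a y s h z : h \notin s ->
  start_label (relabel a h z) y s = start_label a y s.
Proof.
by case: s => //= k s; rewrite inE negb_or ffunE eq_sym => /andP[/negPf->].
Qed.

Lemma walk_weight_relabel a y s h z : h \notin s ->
  walk_weight (relabel a h z) y s = walk_weight a y s.
Proof.
elim: s => //= k s IHs; rewrite inE negb_or ffunE eq_sym => /andP[/negPf-> hs].
by rewrite start_label_relabel // IHs.
Qed.

(** Repeated matrix multiplication creates one intermediate index per factor after the first; [a]
    stores it at the element of [s] whose row index it is. *)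
Lemma kernel_prod_walk s h x y : uniq s ->
  D (g h * \prod_(k <- s) g k)%g x y =
  \sum_(a | supported x0 (mem s) a)
     D (g h) x (start_label a y s) * walk_weight a y s.
Proof.
elim: s h x => [|k s IHs] h x /=.
  by rewrite big_nil mulg1 sum_supported_nil /= mulr1.
case/andP=> ks Us; rewrite big_cons D_mul sum_supported_cons //.
apply: eq_bigr => z _; rewrite IHs // mulr_sumr; apply: eq_bigr => a _.
by rewrite ffunE eqxx start_label_relabel // walk_weight_relabel.
Qed.

(** The start [h0] of the cycle is kept apart from the current head [h]: the last element must still
    wrap around to [h0] as the induction shortens the list. *)
Lemma walk_weight_next_at a h0 h s : uniq (h :: s) ->
  walk_weight a (a h0) (h :: s) =
  \prod_(k <- h :: s) D (g k) (a k) (a (next_at k h0 h s)).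
Proof.
elim: s h => [|k s IHs] h; first by rewrite /= big_seq1 mulr1 eqxx.
move=> U; have /andP[hks Uks] := U.
rewrite big_cons -[LHS]/(_ * walk_weight a (a h0) (k :: s)) IHs //.
congr (_ * _); first by rewrite /= eqxx.
apply: eq_big_seq => l lks /=; case: eqP => // lh.
by rewrite -lh lks in hks.
Qed.

(** In a trace the last column index is the first row index, so the walk closes up into a cycle. *)
Lemma kernel_trace_walk (w : X -> R) s h : uniq (h :: s) ->
  \sum_x w x * D (\prod_(k <- h :: s) g k)%g x x =
  \sum_(a | supported x0 (mem (h :: s)) a)
     w (a h) * \prod_(k <- h :: s) D (g k) (a k) (a (next (h :: s) k)).
Proof.
move=> U; have /andP[hs Us] := U.
under [RHS]eq_bigr do rewrite -walk_weight_next_at //.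
rewrite sum_supported_cons //; apply: eq_bigr => x _.
rewrite big_cons kernel_prod_walk // mulr_sumr; apply: eq_bigr => a _.
by rewrite /= !ffunE eqxx start_label_relabel // walk_weight_relabel.
Qed.

End TraceExpansion.

(** * Counting labellings constant on the orbits of an injection *)

Section InvariantLabellings.

Variables (E X : finType) (f : E -> E).
Hypothesis f_inj : injective f.

(** The orbits of [f]; for [face_next phi] they are the faces. *)
Definition fclasses : {set {set E}} :=
  [set [set y | fconnect f x y] | x : E].

Lemma fclass_step x : [set y | fconnect f (f x) y] = [set y | fconnect f x y].
Proof.
apply/setP=> y; rewrite !inE; apply/esym.
exact: (same_connect (fconnect_sym f_inj) (fconnect1 f x)).
Qed.

Lemma fconnect_invariant_eq (T : Type) (b : E -> T) x y :
  (forall z, b (f z) = b z) -> fconnect f x y -> b x = b y.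
Proof.
move=> bf /connectP[p pth ->]; elim: p x pth => //= z p IHp x /andP[/eqP<- pth].
by rewrite -IHp.
Qed.

(** Invariant labellings correspond to [B]-valued functions on orbits, encoded with value [x0] off
    [fclasses] so that [card_pffun_on] counts them. *)
Lemma card_invariant_labellings (B : {set X}) (x0 : X) :
  #|[set b : {ffun E -> X} | [forall x, (b x \in B) && (b (f x) == b x)]]| =
  (#|B| ^ #|fclasses|)%N.
Proof.
rewrite -(card_pffun_on x0 (mem fclasses) (mem B)).
pose ext (c : {ffun {set E} -> X}) : {ffun E -> X} :=
  [ffun x => c [set y | fconnect f x y]].
have cls x : [set y | fconnect f x y] \in fclasses by apply: imset_f.
rewrite -(@card_in_imset _ _ ext); last first.
  move=> c d /pffun_onP[/subsetP sc _] /pffun_onP[/subsetP sd _] ecd.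
  apply/ffunP=> S; have [/imsetP[x _ ->]|nS] := boolP (S \in fclasses).
    by have := congr1 (fun a : {ffun E -> X} => a x) ecd; rewrite !ffunE.
  have out (e : {ffun {set E} -> X}) :
      {subset x0.-support e <= fclasses} -> e S = x0.
    by move=> se; apply/eqP; apply: contraNT nS => eS; apply: se.
  by rewrite !out.
apply: eq_card => b; rewrite inE; apply/forallP/imsetP => [binv | [c cB ->] x].
  (* Invariance of [b] makes the choice of a point in the orbit irrelevant. *)
  pose c := [ffun S : {set E} =>
    if S \in fclasses then
      if [pick x in S] is Some x then b x else x0 else x0].
  have cE x : c [set y | fconnect f x y] = b x.
    rewrite ffunE cls; case: pickP => [y|/(_ x)]; rewrite inE ?connect0 //.
    move=> xy; symmetry; apply: fconnect_invariant_eq xy => z.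
    by case/andP: (binv z) => _ /eqP.
  exists c; last by apply/ffunP=> x; rewrite [RHS]ffunE cE.
  apply/pffun_onP; split.
    apply/subsetP=> S; apply: contraR => nS.
    by rewrite ffunE (negPf nS).
  move=> _ /imageP[S /imsetP[x _ ->] ->]; rewrite cE.
  by case/andP: (binv x).
have /pffun_onP[_ imc] := cB.
rewrite !ffunE fclass_step eqxx andbT; apply: imc.
exact/image_f/cls.
Qed.

End InvariantLabellings.

(** * The block diagonal sum of the irreducible representations *)

Section BlockKernel.

Variables (C : numClosedFieldType) (G : finGroupType) (I : finType).
Variables (n : I -> nat) (rho : forall i, mx_representation C [set: G] (n i)).

Definition label : finType := {i : I & 'I_(n i)}.

Local Notation lab a := (Tagged (fun i => 'I_(n i)) a).

(* The direct sum of all the [rho i], as a block diagonal matrix over [label]. *)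
Definition kernel (g : G) (x y : label) : C :=
  if tag x == tag y then rho (tag x) g (tagged x) (tagged_as x y) else 0.

Lemma kernelE g i (a b : 'I_(n i)) :
  kernel g (lab a) (lab b) = rho i g a b.
Proof. by rewrite /kernel /= eqxx (@tagged_asE _ _ (lab a) b). Qed.

Lemma kernel_neq g x y : tag x != tag y -> kernel g x y = 0.
Proof. by rewrite /kernel => /negPf->. Qed.

Lemma sum_label (F : label -> C) :
  \sum_x F x = \sum_i \sum_(a < n i) F (lab a).
Proof. by rewrite sig_big_dep; apply: eq_bigr => -[]. Qed.

Lemma kernel_mul g h x y :
  kernel (g * h)%g x y = \sum_z kernel g x z * kernel h z y.
Proof.
case: x y => [i a] [j b]; rewrite sum_label (bigD1 i) //=.
rewrite [X in _ = _ + X]big1 => [|k ki]; last first.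
  by apply: big1 => c _; rewrite kernel_neq ?mul0r // eq_sym.
rewrite addr0; have [eij|nij] := eqVneq i j.
  subst j; rewrite kernelE repr_mxM ?inE // mxE.
  by apply: eq_bigr => c _; rewrite !kernelE.
rewrite kernel_neq // big1 // => c _.
by rewrite [kernel h _ _]kernel_neq ?mulr0.
Qed.

Lemma sum_char_kernel (m : I -> C) g :
  \sum_i m i * repr_char (rho i) g = \sum_x m (tag x) * kernel g x x.
Proof.
rewrite sum_label; apply: eq_bigr => i _; rewrite mulr_sumr.
by apply: eq_bigr => a _; rewrite kernelE.
Qed.

Hypothesis irr_rho : forall i, mx_irreducible (rho i).
Hypothesis rho_inj : forall i j, mx_rsim (rho i) (rho j) -> i = j.

(** Entries outside the diagonal blocks vanish; inside them this is Schur orthogonality for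
    inequivalent or equal representations. *)
Lemma kernel_orthogonality x y z w :
  \sum_g kernel g x y * kernel (g^-1)%g z w =
  if [&& x == w, y == z & tag x == tag y] then #|G|%:R / (n (tag x))%:R else 0.
Proof.
case: x y z w => [i a] [j b] [k c] [l d].
have [ij|nij] := eqVneq i j; last first.
  rewrite !andbF big1 // => g _.
  by rewrite kernel_neq ?mul0r.
subst j; have [kl|nkl] := eqVneq k l; last first.
  rewrite [if _ then _ else _]ifF; last first.
    apply: contraNF nkl => /and3P[/eqP/(congr1 tag)/= il].
    by move=> /eqP/(congr1 tag)/= ik _; rewrite -il -ik.
  by apply: big1 => g _; rewrite [X in _ * X]kernel_neq ?mulr0.
subst l; under eq_bigr do rewrite !kernelE.
have [ik|nik] := eqVneq i k; last first.
  rewrite [if _ then _ else _]ifF; last first.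
    by apply: contraNF nik => /and3P[/eqP/(congr1 tag)/= ik _ _]; apply/eqP.
  apply: schur_orthogonality_neq => // /rho_inj eik.
  by rewrite eik eqxx in nik.
subst k; rewrite schur_orthogonality_eq // andbT.
by rewrite !eq_Tagged /=; case: ifP.
Qed.

End BlockKernel.

(** * Moving around vertices, across edges and along faces *)

Section RotationSystems.

Variables (H : digraph) (phi : rotation_system H).
Local Notation E := (edge_end H).
Local Notation V := (vertex H).

Definition end_next (h : E) : E := next (phi (end_vertex h)) h.
Definition opposite_end (h : E) : E := (h.1, ~~ h.2).

Lemma opposite_endK : involutive opposite_end.
Proof. by case=> e b; rewrite /opposite_end /= negbK. Qed.

Lemma mem_rot_end h : h \in phi (end_vertex h).
Proof. by rewrite mem_rot_at. Qed.

Lemma end_vertex_next h : end_vertex (end_next h) = end_vertex h.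
Proof. by apply/eqP; rewrite -(mem_rot_at phi) mem_next mem_rot_end. Qed.

(** Take the first edge of a path from [v] to the source of [e0], or [e0] itself if that path is
    empty. *)
Lemma end_at_vertex : connected_digraph H -> edge H ->
  forall v : V, exists h : E, end_vertex h = v.
Proof.
move=> [_ conn] e0 v; have /connectP[[|u p] /=] := conn v (source e0).
  by move=> _ <-; exists (e0, false).
case/andP=> /existsP[e /orP[/andP[/eqP<- _]|/andP[_ /eqP<-]]] _ _.
  by exists (e, false).
by exists (e, true).
Qed.

(** The list at a vertex is a single cycle of [next], so iterating [end_next] joins any two
    edge-ends there. *)
Lemma constant_on_vertex (T : Type) (t : E -> T) h k :
    (forall h, t (end_next h) = t h) -> end_vertex h = end_vertex k -> t h = t k.
Proof.
move=> tn hk; have kh : k \in phi (end_vertex h) by rewrite mem_rot_at hk.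
have := fconnect_cycle (cycle_next (Defs.rot_uniq phi (end_vertex h))) (mem_rot_end h).
move=> /(_ k); rewrite kh => /connectP[p pth lk].
suff /(_ h erefl p pth) : forall l, end_vertex l = end_vertex h ->
    forall q, fpath (next (phi (end_vertex h))) l q -> t (last l q) = t l.
  by rewrite -lk.
move=> l lh q; elim: q l lh => //= l' q IHq l lh /andP[/eqP ll' pq].
have l'E : l' = end_next l by rewrite /end_next lh.
by rewrite IHq // l'E ?tn ?end_vertex_next.
Qed.

(** Follow a path of adjacent vertices: [end_next] turns around a vertex and [opposite_end] crosses
    an edge. *)
Lemma constant_on_ends (T : Type) (t : E -> T) :
    connected_digraph H ->
    (forall h, t (end_next h) = t h) -> (forall h, t (opposite_end h) = t h) ->
  forall h k, t h = t k.
Proof.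
move=> conn tn to h k; have [_ /(_ (end_vertex h) (end_vertex k))] := conn.
case/connectP=> p pth ek; elim: p h pth ek => [|u p IHp] h /=.
  by move=> _ ek; apply: constant_on_vertex.
case/andP=> /existsP[e he] pth ek.
have [b [eb eu]] : exists b, end_vertex ((e, b) : E) = end_vertex h /\
    end_vertex ((e, ~~ b) : E) = u.
  by case/orP: he => /andP[/eqP<- /eqP<-]; [exists false | exists true].
rewrite -(constant_on_vertex tn eb) -(to (e, b)).
by apply: IHp; rewrite /opposite_end /= eu.
Qed.

Lemma prod_ends (R : comNzRingType) (F : E -> R) :
  \prod_h F h = \prod_e (F (e, true) * F (e, false)).
Proof.
under [RHS]eq_bigr => e _ do rewrite -(big_bool _ (fun b => F (e, b))).
by rewrite pair_bigA; apply: eq_bigr => -[].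
Qed.

Lemma prod_rot (R : comNzRingType) (F : V -> E -> R) :
  \prod_v \prod_(h <- phi v) F v h = \prod_h F (end_vertex h) h.
Proof.
rewrite (partition_big (@end_vertex H) predT) //=; apply: eq_bigr => v _.
rewrite big_uniq ?Defs.rot_uniq //=.
by apply: eq_big => h; rewrite mem_rot_at // => /eqP->.
Qed.

(** Setting [b h = a (opposite_end h)] turns the matching condition into
    [b (face_next phi h) = b h]. *)
Lemma card_face_labellings (X : finType) (B : {set X}) (x0 : X) :
  #|[set a : {ffun E -> X} |
      [forall h, (a h \in B) && (a (opposite_end h) == a (end_next h))]]| =
  (#|B| ^ #|faces phi|)%N.
Proof.
have <- := card_invariant_labellings (face_next_inj (phi := phi)) B x0.
pose op (a : {ffun E -> X}) : {ffun E -> X} := [ffun h => a (opposite_end h)].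
have opK : involutive op.
  by move=> a; apply/ffunP=> h; rewrite !ffunE opposite_endK.
rewrite -(card_imset _ (inv_inj opK)); apply: eq_card => b.
have nextE h : opposite_end (face_next phi h) = end_next h.
  exact: opposite_endK.
rewrite -[b]opK mem_imset; last exact: inv_inj.
move: (op b) => a; rewrite !inE; apply/forallP/forallP=> inv h.
  rewrite !ffunE nextE; have /andP[_ /eqP<-] := inv h.
  by rewrite eqxx andbT; case/andP: (inv (opposite_end h)).
have := inv h; rewrite !ffunE nextE => /andP[_ /eqP->]; rewrite eqxx andbT.
by have := inv (opposite_end h); rewrite !ffunE opposite_endK => /andP[].
Qed.

End RotationSystems.

(** * The partition function of a graph with at least one edge *)

Section PartitionFunction.

Variables (C : numClosedFieldType) (G : finGroupType) (I : finType).
Variables (n : I -> nat) (rho : forall i, mx_representation C [set: G] (n i)).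
Hypothesis irr_rho : forall i, mx_irreducible (rho i).
Hypothesis rho_inj : forall i j, mx_rsim (rho i) (rho j) -> i = j.
Variables (chi : G -> C) (m : I -> C).
Hypothesis chiE : forall g, chi g = \sum_i m i * repr_char (rho i) g.
Variables (H : digraph) (phi : rotation_system H).
Hypotheses (conn : connected_digraph H) (e0 : edge H).

Local Notation E := (edge_end H).
Local Notation V := (vertex H).
Local Notation X := (label n).

(** The default is never taken: connectedness and the edge [e0] give every vertex an edge-end. *)
Definition start_end (v : V) : E := head (e0, true) (phi v).

Lemma rot_start v : phi v = start_end v :: behead (phi v).
Proof.
have [h hv] := end_at_vertex conn e0 v; rewrite /start_end.
by have := mem_rot_at phi v h; rewrite hv eqxx; case: (phi v).
Qed.

Lemma end_vertex_start v : end_vertex (start_end v) = v.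
Proof. by apply/eqP; rewrite -(mem_rot_at phi) rot_start mem_head. Qed.

(** The nonvanishing condition of [kernel_orthogonality] for the row and column labels at the head
    and tail of [e]. *)
Definition edge_compatible (a : {ffun E -> X}) e :=
  [&& a (e, true) == a (end_next phi (e, false)),
      a (end_next phi (e, true)) == a (e, false)
    & tag (a (e, true)) == tag (a (end_next phi (e, true)))].

Definition face_compatible i (a : {ffun E -> X}) :=
  [forall h, (a h \in [set x : X | tag x == i]) &&
             (a (opposite_end h) == a (end_next phi h))].

Lemma partition_function_labellings (x0 : X) :
  partition_function chi phi =
  \sum_(a : {ffun E -> X}) (\prod_v m (tag (a (start_end v)))) *
    \prod_e (if edge_compatible a e then #|G|%:R / (n (tag (a (e, true))))%:R
             else 0).
Proof.
pose g (kappa : {ffun edge H -> G}) (h : E) : G :=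
  (if h.2 then kappa h.1 else (kappa h.1)^-1)%g.
pose F (kappa : {ffun edge H -> G}) v (a : {ffun E -> X}) : C :=
  m (tag (a (start_end v))) *
  \prod_(h <- phi v) kernel rho (g kappa h) (a h) (a (next (phi v) h)).
have locE kappa v : chi (\prod_(h <- phi v) g kappa h)%g =
    \sum_(a | supported x0 [pred h | end_vertex h == v] a) F kappa v a.
  rewrite chiE sum_char_kernel /F rot_start.
  have U := Defs.rot_uniq phi v; rewrite rot_start in U.
  rewrite (kernel_trace_walk x0 (kernel_mul rho) (g kappa)
             (fun x => m (tag x)) U).
  apply: eq_bigl; apply: eq_supported => h.
  by rewrite -rot_start /= -(mem_rot_at phi).
have Fext kappa v (a b : {ffun E -> X}) :
    (forall h, end_vertex h = v -> a h = b h) -> F kappa v a = F kappa v b.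
  move=> ab; rewrite /F ab ?end_vertex_start //; congr (_ * _).
  apply: eq_big_seq => h; rewrite mem_rot_at => /eqP hv.
  by rewrite !ab // -hv end_vertex_next.
transitivity (\sum_(kappa : {ffun edge H -> G}) \sum_a \prod_v F kappa v a).
  apply: eq_bigr => kappa _; rewrite -(prod_sum_supported x0 (Fext kappa)).
  by apply: eq_bigr => v _; apply: locE.
rewrite exchange_big; apply: eq_bigr => a _ /=.
under eq_bigr => kappa _ do rewrite big_split /= prod_rot prod_ends.
rewrite -mulr_sumr; congr (_ * _).
(* The group elements on distinct edges are summed independently. *)
rewrite -(bigA_distr_bigA (fun e g =>
  kernel rho g (a (e, true)) (a (end_next phi (e, true))) *
  kernel rho (g^-1)%g (a (e, false)) (a (end_next phi (e, false))))).
by apply: eq_bigr => e _; rewrite kernel_orthogonality.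
Qed.

Lemma edge_compatible_face a :
  (forall e, edge_compatible a e) -> face_compatible (tag (a (e0, true))) a.
Proof.
move=> ok.
have aop h : a (opposite_end h) = a (end_next phi h).
  by case: h => e []; case/and3P: (ok e) => /eqP e1 /eqP e2 _; rewrite /= ?e1 ?e2.
have tagn h : tag (a (end_next phi h)) = tag (a h).
  (* At the tail of [e], the three conditions are chained through its head. *)
  case: h => e []; case/and3P: (ok e) => /eqP e1 /eqP e2 /eqP e3; first by [].
  by rewrite -e1 e3 e2.
apply/forallP=> h; rewrite inE aop eqxx andbT; apply/eqP.
apply: (constant_on_ends (t := fun h => tag (a h)) conn tagn) => k.
by rewrite aop tagn.
Qed.

Lemma face_compatible_edge i a e : face_compatible i a -> edge_compatible a e.
Proof.
move=> /forallP ok; have tagE h : tag (a h) = i.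
  by case/andP: (ok h); rewrite inE => /eqP.
apply/and3P; split; last by rewrite !tagE.
  by case/andP: (ok (e, false)).
by rewrite eq_sym; case/andP: (ok (e, true)).
Qed.

(** The label at [(e0, true)] determines [i], so the right-hand sum has at most one term; this form
    allows the sums over [a] and [i] to be exchanged. *)
Lemma labelling_weight (a : {ffun E -> X}) :
  (\prod_v m (tag (a (start_end v)))) *
    \prod_e (if edge_compatible a e then #|G|%:R / (n (tag (a (e, true))))%:R
             else 0) =
  \sum_(i | face_compatible i a) m i ^+ #|V| * (#|G|%:R / (n i)%:R) ^+ #|edge H|.
Proof.
have [/forallP ok|] := boolP [forall e, edge_compatible a e]; last first.
  rewrite negb_forall => /existsP[e bad].
  rewrite [X in _ * X](bigD1 e) //= (negPf bad) mul0r mulr0 big1 // => i /=.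
  by move/(face_compatible_edge e) => ok; rewrite ok in bad.
have fc := edge_compatible_face ok; set i := tag _ in fc.
have tagE j : face_compatible j a -> forall h, tag (a h) = j.
  by move=> /forallP fj h; case/andP: (fj h); rewrite inE => /eqP.
rewrite (big_pred1 i) => [|j]; last first.
  by apply/idP/eqP => [/tagE/(_ (e0, true)) <- // | ->].
congr (_ * _).
  by rewrite -prodr_const; apply: eq_bigr => v _; rewrite (tagE i).
by rewrite -prodr_const; apply: eq_bigr => e _; rewrite ok (tagE i).
Qed.

Lemma card_label_block i : #|[set x : X | tag x == i]| = n i.
Proof.
have inj : injective (fun a => Tagged (fun j => 'I_(n j)) (a : 'I_(n i))).
  by move=> a b /eqP; rewrite eq_Tagged => /eqP.
rewrite -[RHS]card_ord -(card_imset _ inj); apply: eq_card => -[j b].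
rewrite inE; apply/eqP/imsetP => [/= ji | [a _ ->] //].
by subst j; exists b.
Qed.

Lemma partition_function_faces (x0 : X) :
  partition_function chi phi =
  \sum_i (n i)%:R ^+ #|faces phi| *
     (m i ^+ #|V| * (#|G|%:R / (n i)%:R) ^+ #|edge H|).
Proof.
rewrite (partition_function_labellings x0).
under eq_bigr do rewrite labelling_weight.
rewrite (exchange_big_dep predT) //=; apply: eq_bigr => i _.
rewrite sumr_const -natrX -[in (n i ^ _)%N](card_label_block i).
rewrite -(card_face_labellings phi _ x0) [RHS]mulr_natl.
by congr (_ *+ _); apply: eq_card => a; rewrite inE.
Qed.

End PartitionFunction.

(** * Final formula, including the graph without edges *)

Theorem theorem2p2 (R : realType) (G : finGroupType)
    (I : finType) (n : I -> nat)
    (rho : forall i : I, mx_representation R[i] [set: G] (n i))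
    (hrho : complete_irreps rho)
    (chi : G -> R[i]) (hchi : class_function chi)
    (m : I -> R[i])
    (hm : forall g : G, chi g = \sum_(i : I) m i * repr_char (rho i) g)
    (H : digraph) (phi : rotation_system H)
    (Hconn : connected_digraph H) :
  partition_function chi phi =
    #|G|%:R ^+ #|edge H| *
    \sum_(i : I)
       (repr_char (rho i) 1%g) ^ ((num_faces phi)%:Z - #|edge H|%:Z)
         * m i ^+ #|vertex H|.
Proof.
have [irr_rho rho_inj _] := hrho.
have char1 i : repr_char (rho i) 1%g = (n i)%:R.
  by rewrite /repr_char repr_mx1 mxtrace1.
have n_gt0 i : (0 < n i)%N by have /mx_irrP[] := irr_rho i.
have nz_n i : (n i)%:R != 0 :> R[i] by rewrite Num.Theory.pnatr_eq0 -lt0n.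
have [e0 _|noE] := pickP (edge H).
  have -> : num_faces phi = #|faces phi|.
    have E_gt0 : (0 < #|edge H|)%N by apply/card_gt0P; exists e0.
    by rewrite /num_faces eqn0Ngt E_gt0 andbF.
  have [i0 _|noI] := pickP I.
    pose x0 : label n := Tagged (fun i => 'I_(n i)) (Ordinal (n_gt0 i0)).
    rewrite (partition_function_faces irr_rho rho_inj hm phi Hconn e0 x0).
    rewrite mulr_sumr; apply: eq_bigr => i _.
    rewrite char1 expfzDr // -exprnP -invr_expz -exprnP expr_div_n.
    rewrite [m i ^+ _ * _]mulrC !mulrA.
    by congr (_ * _ * _); rewrite mulrC.
  (* With an empty index type [chi] is zero, and so is the factor at [source e0]. *)
  rewrite [in RHS]big_pred0 // mulr0; apply: big1 => kappa _.
  by rewrite (bigD1 (source e0)) //= hm [\sum_i _]big_pred0 ?mul0r.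
have E0 : #|edge H| = 0%N by apply: eq_card0 => e; have := noE e.
have [Vpos conn] := Hconn.
(* Without edges no two vertices are adjacent, so connectedness leaves one vertex. It has one face
   by convention, and the formula reduces to the value of [chi] at [1]. *)
have V1 : #|vertex H| = 1%N.
  apply/eqP; rewrite eqn_leq Vpos andbT; apply/fintype_le1P=> u v.
  by have /connectP[[|w p] //= /andP[/existsP[e]]] := conn u v; have := noE e.
rewrite /num_faces E0 V1 /= subr0 mul1r.
transitivity (\sum_(kappa : {ffun edge H -> G}) \prod_(v : vertex H) chi 1%g).
  apply: eq_bigr => kappa _; apply: eq_bigr => v _.
  by rewrite big1_seq // => -[e b] _; have := noE e.
rewrite sumr_const prodr_const card_ffun E0 V1 expn0 mulr1n hm.
by apply: eq_bigr => i _; rewrite mulrC.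
Qed.
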